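(* For $a,b\in\mathbb{Z}$ with $a<0<b$, let $\mu^{\mathrm{stoch}}_{a,b}$ denote the stationary distribution of the stochastic sandpile Markov chain with uniform toppling rule on $[[a,b]]=\{a,a+1,\dots,b-1,b\}$, where the outside of $[[a,b]]$ is identified as the sink. Then: (USS1) For all $a,b\in\mathbb{Z}$ with $a<0<b$, $$\mu^{\mathrm{stoch}}_{a,b}(\mathbf{1}_{[[a,b]]})=\frac{1}{2}+\frac{1}{2(|a|+b+2)}.$$ (USS2) For all $a,b\in\mathbb{Z}$ with $a<0<b$ and all $j\in[[a,b]]$, $$\mu^{\mathrm{stoch}}_{a,b}(\mathbf{1}_{[[a,b]]}-\delta_j)=\frac{1}{2(|a|+b+2)}.$$ (USS3) The infinite volume limit of the measures $\mu^{\mathrm{stoch}}_{a,b}$ as $[[a,b]]\uparrow\mathbb{Z}$ exists and equals the Dirac measure at the full configuration $\mathbf{1}_{\mathbb{Z}}$ on $\mathbb{Z}$. That is, for all sequences $(a_n)_{n\in\mathbb{N}}$ of negative integers and $(b_n)_{n\in\mathbb{N}}$ of positive integers with $\lim_{n\to\infty}a_n=-\infty$ and $\lim_{n\to\infty}b_n=\infty$, and all finite subsets $A\subseteq\mathbb{Z}$, $$\lim_{n\to\infty}\mu^{\mathrm{stoch}}_{a_n,b_n}(\eta|_A=\mathbf{1}_A)=1.$$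
   Context: Notation: $[[a,b]]:=\{a,a+1,\dots,b\}$. For a set $S\subseteq\mathbb{Z}$, $\mathbf{1}_S$ is the full configuration with one particle at every vertex of $S$. $\delta_j$ is the configuration with one particle at $j$ and $0$ elsewhere; $\delta_j$ is the zero function on $[[a,b]]$ if $j\notin[[a,b]]$. Uniform toppling rule: a sandpile configuration on $[[a,b]]$ is a function $\eta:[[a,b]]\to\mathbb{Z}$. For each $v\in[[a,b]]$, let $(L_v^i)_{i\in\mathbb{N}}$ be i.i.d. random toppling instructions, independent for different $v$, each being with probability $1/3$ ''left'' (one particle moves from $v$ to $v-1$, i.e. add $\delta_{v-1}-\delta_v$), with probability $1/3$ ''right'' (add $\delta_{v+1}-\delta_v$), and with probability $1/3$ ''split'' (two particles leave $v$, one to each side, i.e. add $\delta_{v-1}+\delta_{v+1}-2\delta_v$). Particles sent outside $[[a,b]]$ (to the sink) are removed. Stabilization: $\eta$ is unstable at $v$ if $\eta(v)\ge 2$, and stable if it is unstable at no vertex. Start with $\eta_0=\eta$ and odometer $u_0=0$. While $\eta_n$ is not stable, choose $v_{n+1}$ uniformly at random among the unstable vertices of $\eta_n$ and set $\eta_{n+1}=\eta_n+L_{v_{n+1}}^{u_n(v_{n+1})+1}$, $u_{n+1}=u_n+\delta_{v_{n+1}}$. This terminates almost surely in finitely many steps; the final (random) stable configuration is denoted $\eta^\circ$. Stochastic sandpile Markov chain on $[[a,b]]$: the Markov chain on stable configurations given by $\eta_{n+1}=(\eta_n+\delta_{X_n})^\circ$, where $(X_n)$ are i.i.d. uniform on $[[a,b]]$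 and fresh independent toppling instructions are used in every time step. Its set of recurrent configurations is $\mathcal{R}_{a,b}=\{\mathbf{1}_{[[a,b]]}\}\cup\{\mathbf{1}_{[[a,b]]}-\delta_j: j\in[[a,b]]\}$, and $\mu^{\mathrm{stoch}}_{a,b}$ is its stationary distribution, supported on $\mathcal{R}_{a,b}$. *)

(* Defs.v *)
From HB Require Import structures.
From mathcomp Require Import all_boot all_order all_algebra finmap.
From mathcomp Require Import all_classical all_reals all_analysis.
From mathcomp Require Import zify.

Set Implicit Arguments.
Unset Strict Implicit.
Unset Printing Implicit Defensive.

Import Order.TTheory GRing.Theory Num.Theory.
Import numFieldNormedType.Exports.

Local Open Scope classical_set_scope.
Local Open Scope ring_scope.

Definition zrange (a b : int) : seq int :=
  if a <= b then [seq a + k%:Z | k <- iota 0 `|b - a|.+1] else [::].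

Lemma mem_zrange (a b x : int) : (x \in zrange a b) = (a <= x <= b).
Proof.
rewrite /zrange; case: ifP => [ab|ab]; last first.
  by rewrite in_nil; apply/esym/negP => /andP[ax xb]; lia.
apply/mapP/idP => [[k]|axb].
  by rewrite mem_iota => kn ->; lia.
by exists `|x - a|%N; [rewrite mem_iota|]; lia.
Qed.

Definition vertex (a b : int) := seq_sub (zrange a b).

Definition config (a b : int) := {ffun vertex a b -> int}.

(* [delta j] is the zero configuration when j lies outside [[a,b]], so that
   adding it models the loss of a particle to the sink. *)
Definition delta (a b : int) (j : int) : config a b :=
  [ffun v => ((val v == j) : nat)%:Z].

Definition full (a b : int) : config a b := [ffun => 1].

Inductive instruction := ToLeft | ToRight | Split.

Definition topple (a b : int) (v : vertex a b) (t : instruction) : config a b :=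
  match t with
  | ToLeft  => delta a b (val v - 1) - delta a b (val v)
  | ToRight => delta a b (val v + 1) - delta a b (val v)
  | Split   => delta a b (val v - 1) + delta a b (val v + 1)
               - delta a b (val v) *+ 2
  end.

Definition unstable (a b : int) (eta : config a b) : {set vertex a b} :=
  [set v | 2 <= eta v]%SET.

Definition stable (a b : int) (eta : config a b) : bool :=
  unstable eta == finset.set0.

Definition odometer (a b : int) := {ffun vertex a b -> nat}.

(* One step of the stabilization with stacks L at the chosen vertex v.  Stack
   entries are numbered from 1, so L _ 0 is never used.  A stable configuration
   is left unchanged. *)
Definition stab_step (a b : int) (L : vertex a b -> nat -> instruction)
    (v : vertex a b) (s : config a b * odometer a b) :
    config a b * odometer a b :=
  if stable s.1 then s
  else (s.1 + topple v (L v (s.2 v).+1),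
        [ffun w => s.2 w + (w == v)]%N).

(* The pair (eta_n, u_n); [c n] is the vertex v_(n+1) toppled in step n + 1. *)
Fixpoint stab_state (a b : int) (L : vertex a b -> nat -> instruction)
    (c : nat -> vertex a b) (eta : config a b) (n : nat) :
    config a b * odometer a b :=
  match n with
  | 0%N => (eta, [ffun => 0%N])
  | n'.+1 => stab_step L (c n') (stab_state L c eta n')
  end.

Local Open Scope ereal_scope.

Section Randomness.
Context (R : realType) (a b : int).

Definition iid_uniform_instructions d (T : measurableType d)
    (P : probability T R) (L : vertex a b -> nat -> T -> instruction) :=
  [/\ (forall v i (B : set instruction), measurable (L v i @^-1` B)),
      (forall v i t, P (L v i @^-1` [set t]) = (3^-1)%:E) &
      (forall (J : {fset vertex a b * nat})
              (B : vertex a b * nat -> set instruction),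
         P [set w | forall p, p \in J -> B p (L p.1 p.2 w)] =
         \prod_(p <- J) P (L p.1 p.2 @^-1` B p))].

(* [c eta n] is the random vertex v_(n+1) in the stabilization of eta: given
   the stacks and v_1, ..., v_n, it is uniform on the unstable vertices of
   eta_n.  Nothing is required of it once eta_n is stable. *)
Definition uniform_choices d (T : measurableType d) (P : probability T R)
    (L : vertex a b -> nat -> T -> instruction)
    (c : config a b -> nat -> T -> vertex a b) :=
  (forall eta n (B : set (vertex a b)), measurable (c eta n @^-1` B)) /\
  (forall eta n (J : {fset vertex a b * nat})
          (B : vertex a b * nat -> set instruction)
          (h : nat -> vertex a b) (xi : config a b) (x : vertex a b),
     x \in unstable xi ->
     let past := [set w |
       [/\ forall p, p \in J -> B p (L p.1 p.2 w),
           forall k, (k < n)%N -> c eta k w = h k &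
           (stab_state (fun v i => L v i w) (fun k => c eta k w) eta n).1
             = xi]] in
     P (past `&` [set w | c eta n w = x])
       = (#|unstable xi|%:R^-1)%:E * P past).

Record toppling_model := TopplingModel {
  tm_disp : measure_display;
  tm_space : measurableType tm_disp;
  tm_prob : probability tm_space R;
  tm_instr : vertex a b -> nat -> tm_space -> instruction;
  tm_choice : config a b -> nat -> tm_space -> vertex a b;
  tm_instrP : iid_uniform_instructions tm_prob tm_instr;
  tm_choiceP : uniform_choices tm_prob tm_instr tm_choice }.

Variable M : toppling_model.

Definition stabilizes_to (eta xi : config a b) : set (tm_space M) :=
  [set w | exists n,
     let eta_n := (stab_state (fun v i => tm_instr v i w)
                     (fun k => tm_choice (t := M) eta k w) eta n).1 in
     stable eta_n /\ eta_n = xi].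

Definition transition (eta xi : config a b) : \bar R :=
  \sum_(x : vertex a b)
     (#|{: vertex a b}|%:R^-1)%:E *
     tm_prob M (stabilizes_to (eta + delta a b (val x))%R xi).

(* Configurations are integer valued, hence there are infinitely many stable
   ones and the sums below are infinite. *)
Definition stationary (mu : config a b -> R) :=
  [/\ (forall eta, (0 <= mu eta)%R),
      (forall eta, ~~ stable eta -> mu eta = 0%R),
      \esum_(eta in setT) (mu eta)%:E = 1 &
      (forall xi,
         (mu xi)%:E = \esum_(eta in setT) ((mu eta)%:E * transition eta xi))].

Definition mu_stoch : config a b -> R := xget (fun=> 0%R) stationary.

Definition mu_stoch_event (E : set (config a b)) : \bar R :=
  \esum_(eta in E) (mu_stoch eta)%:E.

End Randomness.

Definition full_on (a b : int) (A : {fset int}) : set (config a b) :=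
  [set eta | forall x, x \in A -> exists2 v, val v = x & eta v = 1%R].

(* Main.v *)
(* Encode a configuration by a bit on each of the n = b - a + 2 edges of [[a,b]]
   (edges to the sink included), the content of a vertex being 1 + (bit on its
   right) - (bit on its left).  The unstable vertices are the patterns 01, and a
   toppling replaces 01 by 11, 00 or 10 with probability 1/3 each.  The stable
   strings are 1^k 0^(n-k): full for k = 0 and k = n, one hole otherwise.
   - The squared number of ones has drift 2/3 as long as the string is unstable,
     so stabilization terminates almost surely.
   - For every real z, the product over the edges j of (z + j + 2 [bit j = 0])
     is a martingale under every toppling, because
     (c+2)(c+1) = (c(c+1) + (c+2)(c+3) + c(c+3))/3.  On the stable strings these
     polynomials in z are linearly independent, so they determine the law of the
     final string.
   On strings of the form 1..1 0..0 1..1 0..0 they telescope, which shows that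
   adding a particle at any fixed vertex preserves the claimed distribution.
   For uniqueness, a stationary distribution cannot leak into the recurrent
   class, every stable configuration reaches the full one by filling holes, and
   on the recurrent class the difference of two stationary distributions is
   compared with its absolute value. *)
Require Import Defs.
From HB Require Import structures.
From mathcomp Require Import all_boot all_order all_algebra finmap.
From mathcomp Require Import all_classical all_reals all_analysis.
From mathcomp Require Import zify ring lra.
Set Implicit Arguments.
Unset Strict Implicit.
Unset Printing Implicit Defensive.
Import Order.TTheory GRing.Theory Num.Theory.
Import numFieldNormedType.Exports.
Local Open Scope classical_set_scope.
Local Open Scope ring_scope.

(** * Sums over instructions and total probability over finite partitions *)

Definition instruction_code (t : instruction) : option bool :=
  match t with
  | ToLeft => Some true | ToRight => Some false | Defs.Split => None
  end.

Definition instruction_decode (o : option bool) : instruction :=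
  match o with
  | Some true => ToLeft | Some false => ToRight | None => Defs.Split
  end.

Lemma instruction_codeK : cancel instruction_code instruction_decode.
Proof. by case. Qed.

HB.instance Definition _ :=
  Finite.copy instruction (can_type instruction_codeK).

Lemma big_instruction (V : nmodType) (F : instruction -> V) :
  \sum_t F t = F ToLeft + F ToRight + F Defs.Split.
Proof.
rewrite (bigD1 ToLeft) // (bigD1 ToRight) //= (bigD1 Defs.Split) //=.
by rewrite big1 ?addr0 ?addrA // => -[].
Qed.

Lemma measure_finite_preimages (R : realType) d (T : measurableType d)
    (P : probability T R) (X : finType) (f : T -> X) (E : set T) :
  measurable E -> (forall x, measurable (f @^-1` [set x])) ->
  P E = (\sum_x P (E `&` f @^-1` [set x]))%E.
Proof.
move=> mE mf.
have {1}-> : E = \bigcup_(x in [set: X]) (E `&` f @^-1` [set x]).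
  apply/seteqP; split=> [w Ew|w [x _ []] //].
  by exists (f w).
rewrite measure_fin_bigcup.
- rewrite fsbig_finite; last exact: finite_finset.
  apply: perm_big.
  rewrite uniq_perm ?fset_uniq ?index_enum_uniq // => x.
  by rewrite in_fset_set ?mem_index_enum ?in_setT //; exact: finite_finset.
- exact: finite_finset.
- by move=> x y _ _ [w [[_ <-] [_ <-]]].
- by move=> x _; apply: measurableI.
Qed.

(** * Stabilization as iteration of a mean operator *)

Section StabilizationLaw.
Context (R : realType) (a b : int) (M : toppling_model R a b).

Local Notation P := (tm_prob M).
Local Notation instr := (tm_instr (t := M)).
Local Notation choice := (tm_choice (t := M)).
Local Notation state eta w := (stab_state (fun v i => instr v i w)
  (fun k => choice eta k w) eta).

(** Transition operator of one toppling step, acting on observables. The state type is left open so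
    that the same operator serves configurations and edge strings. *)
Definition toppling_mean (S : Type) (phi : S -> config a b)
    (step : S -> vertex a b -> instruction -> S) (F : S -> R) (s : S) : R :=
  if stable (phi s) then F s else
  #|unstable (phi s)|%:R^-1 *
    \sum_(x in unstable (phi s)) 3^-1 * \sum_(t : instruction) F (step s x t).

Definition config_mean : (config a b -> R) -> config a b -> R :=
  toppling_mean id (fun eta x t => eta + topple x t).

Lemma stab_state_stable (L : vertex a b -> nat -> instruction) c eta m r :
  stable (stab_state L c eta m).1 ->
  stab_state L c eta (m + r) = stab_state L c eta m.
Proof.
move=> st; elim: r => [|r IH]; first by rewrite addn0.
by rewrite addnS /= IH /stab_step st.
Qed.

(** The stack entry read next sits at a random height. Splitting over the countably many values of
    state, chosen vertex and instruction fixes that height on each piece. *)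
Lemma measurable_state eta m (S : set (config a b * odometer a b)) :
  measurable [set w | S (state eta w m)].
Proof.
have [mL _ _] := tm_instrP M; have [mc _] := tm_choiceP M.
elim: m S => [|m IH] S.
  rewrite /=; have [Se|nSe] := pselect (S (eta, [ffun=> 0%N])).
    by rewrite (_ : [set _ | _] = setT)//; apply/seteqP; split.
  by rewrite (_ : [set _ | _] = set0)//; apply/seteqP; split.
have -> : [set w | S (state eta w m.+1)] =
  \bigcup_(q : config a b * odometer a b * vertex a b * instruction)
    ([set w | state eta w m = q.1.1] `&` (choice eta m @^-1` [set q.1.2]) `&`
     (instr q.1.2 (q.1.1.2 q.1.2).+1 @^-1` [set q.2]) `&`
     [set _ | S (stab_step (fun _ _ => q.2) q.1.2 q.1.1)]).
  apply/seteqP; split=> [w /= Sw|w [[[s x] t] _] /= [[[<- <-] <-]]//].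
  by exists (state eta w m, choice eta m w,
          instr (choice eta m w) ((state eta w m).2 (choice eta m w)).+1 w).
apply: countable_bigcupT_measurable => [|[[s x] t]]; first exact: countableP.
apply: measurableI; last first.
  rewrite /=; have [Se|nSe] := pselect (S (stab_step (fun _ _ => t) x s)).
    by rewrite (_ : [set _ | _] = setT)//; apply/seteqP; split.
  by rewrite (_ : [set _ | _] = set0)//; apply/seteqP; split.
apply: measurableI; last exact: mL.
by apply: measurableI; [exact: (IH [set s])|exact: mc].
Qed.

Definition path_event eta (J : {fset vertex a b * nat})
    (tau : vertex a b * nat -> instruction) (h : nat -> vertex a b) (m : nat) :=
  [set w | (forall p, p \in J -> instr p.1 p.2 w = tau p) /\
           (forall k, (k < m)%N -> choice eta k w = h k)].

Lemma measurable_path_event eta J tau h m :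
  measurable (path_event eta J tau h m).
Proof.
have [mL _ _] := tm_instrP M; have [mc _] := tm_choiceP M.
rewrite (_ : path_event _ _ _ _ _ =
  (\bigcap_(p in [set` J]) (instr p.1 p.2 @^-1` [set tau p])) `&`
  (\bigcap_(k in `I_m) (choice eta k @^-1` [set h k]))) //.
by apply: measurableI; apply: fin_bigcap_measurable.
Qed.

Lemma card_unstable_gt0 (xi : config a b) :
  ~~ stable xi -> (0 < #|unstable xi|)%N.
Proof. by rewrite /stable -finset.cards_eq0 lt0n. Qed.

(** [uniform_choices] prescribes masses at unstable vertices only. These already add up to the mass
    of the path event, so a stable vertex is chosen with probability 0. *)
Lemma choice_law eta J tau h m xi x :
  path_event eta J tau h m `<=` [set w | (state eta w m).1 = xi] ->
  ~~ stable xi ->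
  P (path_event eta J tau h m `&` choice eta m @^-1` [set x]) =
  (((x \in unstable xi)%:R / #|unstable xi|%:R)%:E *
     P (path_event eta J tau h m))%E.
Proof.
move=> Axi unst; have [mc Pc] := tm_choiceP M.
set A := path_event eta J tau h m in Axi *.
have mA : measurable A by exact: measurable_path_event.
have lawU y : y \in unstable xi ->
    P (A `&` choice eta m @^-1` [set y]) = ((#|unstable xi|%:R^-1)%:E * P A)%E.
  move=> yU; rewrite -[X in (_ * P X)%E](_ : [set w |
       [/\ forall p, p \in J -> [set tau p] (instr p.1 p.2 w),
           forall k, (k < m)%N -> choice eta k w = h k &
           (state eta w m).1 = xi]] = A).
    rewrite -(Pc eta m J (fun p => [set tau p]) h xi y yU) /=; congr (P _).
    apply/seteqP; split=> [w [Aw cw]|w [[JA hA _] cw]]; split=> //.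
    by split; [exact: Aw.1|exact: Aw.2|exact: Axi].
  apply/seteqP; split=> [w [JA hA _]|w Aw]; first by split.
  by split; [exact: Aw.1|exact: Aw.2|exact: Axi].
have [xU|xU] := boolP (x \in unstable xi); first by rewrite mul1r lawU.
rewrite mul0r mul0e.
have finPA : P A \is a fin_num by exact: fin_num_measure.
have := measure_finite_preimages P mA (fun y => mc eta m [set y]).
rewrite (bigID (mem (unstable xi)))/=.
rewrite (eq_bigr (fun=> (#|unstable xi|%:R^-1)%:E * P A)%E); last first.
  by move=> y yU; exact: lawU.
rewrite -(fineK finPA) -EFinM sumEFin sumr_const.
rewrite -[X in (X%:E + _)%E]mulr_natl mulrA mulfV ?pnatr_eq0 -?lt0n ?card_unstable_gt0//.
rewrite mul1r => /(congr1 (fun z => z - (fine (P A))%:E)%E).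
rewrite subee// addeAC subee// add0e => /esym s0.
apply/eqP; rewrite eq_le measure_ge0 andbT -s0 (bigD1 x)//= leeDl//.
by apply: sume_ge0 => y _; exact: measure_ge0.
Qed.

(* Induction on the number r of remaining steps.  [J] holds the stack entries
   read so far and [kappa] the probability of the choices made so far; the last
   hypothesis is required for every larger set of entries, so that the next,
   unread, instruction stays independent of the past. *)
Lemma state_path_law eta zeta r : forall m h tau xi (u : odometer a b)
    (kappa : R) (J : {fset vertex a b * nat}),
  (forall p, p \in J -> (p.2 <= u p.1)%N) ->
  path_event eta J tau h m `<=` [set w | state eta w m = (xi, u)] ->
  (forall J' tau', J `<=` J' -> {in J, tau' =1 tau} ->
     P (path_event eta J' tau' h m) = (kappa * 3^-1 ^+ #|` J'|)%:E)%fset ->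
  P (path_event eta J tau h m `&` [set w | (state eta w (m + r)).1 = zeta]) =
  (kappa * 3^-1 ^+ #|` J| *
    iter r config_mean (fun xi => (xi == zeta)%:R) xi)%:E.
Proof.
elim: r => [|r IH] m h tau xi u kappa J freshJ detJ lawJ.
  rewrite addn0 /=.
  have [<-|neq] := eqVneq xi zeta.
    rewrite mulr1 -(lawJ J tau)//; congr (P _).
    by apply/seteqP; split=> [w []//|w Aw]; split=> //=; rewrite detJ.
  rewrite mulr0 (_ : _ `&` _ = set0) ?measure0 // -subset0 => w [Aw] /=.
  by rewrite detJ //= => /eqP; rewrite (negbTE neq).
rewrite iterS /config_mean {1}/toppling_mean /=.
case: ifPn => [st|unst].
  rewrite -(IH _ _ _ _ _ _ _ freshJ detJ lawJ); congr (P _).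
  apply/seteqP; split=> w [Aw stw]; split=> //; move: stw; rewrite /= addnS /=;
    by rewrite !stab_state_stable /stab_step ?detJ // ?st.
have [mc _] := tm_choiceP M; have [mL _ _] := tm_instrP M.
rewrite (measure_finite_preimages P _ (fun y => mc eta m [set y])); last first.
  apply: measurableI; first exact: measurable_path_event.
  exact: (measurable_state eta (m + r.+1) [set s | s.1 = zeta]).
rewrite mulrCA mulr_sumr mulr_sumr -sumEFin [RHS]big_mkcond /=.
apply: eq_bigr => x _.
rewrite (measure_finite_preimages P _ (fun t => mL x (u x).+1 [set t])); last first.
  apply: measurableI => //; apply: measurableI; first exact: measurable_path_event.
  exact: (measurable_state eta (m + r.+1) [set s | s.1 = zeta]).
(* The next unread entry at [x]: entries of [J] have height at most [u], so [p] is fresh. *)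
pose p := (x, (u x).+1).
pose h' k := if k == m then x else h k.
have pJ : p \notin J by apply/negP => /freshJ /=; rewrite ltnn.
(* The probability of choosing [x] is absorbed here; it vanishes for stable [x]. *)
pose kappa' := kappa * (x \in unstable xi)%:R / #|unstable xi|%:R.
transitivity (\sum_(t : instruction) (kappa' * 3^-1 ^+ #|` J|.+1 *
   iter r config_mean (fun xi => (xi == zeta)%:R) (xi + topple x t))%:E)%E; last first.
  rewrite sumEFin -mulr_sumr /kappa' exprS /config_mean.
  case: ifP => _; last by rewrite mulr0 !mul0r.
  by congr (_%:E); rewrite mulr1; set S := \sum_t _; ring.
apply: eq_bigr => t _.
pose tau' q := if q == p then t else tau q.
(* Fixing the next choice and instruction gives a path event again, with one more entry and one more
   choice. *)
have -> : path_event eta J tau h m `&` [set w | (state eta w (m + r.+1)).1 = zeta] `&`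
    choice eta m @^-1` [set x] `&` instr x (u x).+1 @^-1` [set t] =
  path_event eta (p |` J)%fset tau' h' m.+1 `&`
    [set w | (state eta w (m.+1 + r)).1 = zeta].
  rewrite addSnnS; apply/seteqP; split=> [w [[[[JA hA] stw] cw] Lw]|w [[JA hA] stw]].
    split=> //; split=> [q|k].
      rewrite !inE => /orP[/eqP->|qJ]; first by rewrite /tau' eqxx.
      by rewrite /tau'; case: eqP => [->//|_]; exact: JA.
    rewrite ltnS leq_eqVlt => /orP[/eqP->|km]; first by rewrite /h' eqxx.
    by rewrite /h' ltn_eqF//; exact: hA.
  have Aw : path_event eta J tau h m w.
    split=> [q qJ|k km].
      rewrite JA ?inE ?qJ ?orbT// /tau'; case: eqP => // qp.
      by rewrite qp (negbTE pJ) in qJ.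
    by rewrite hA ?ltnS 1?ltnW// /h' ltn_eqF.
  split; first by split=> //; rewrite /= hA// /h' eqxx.
  by have /= := JA p; rewrite !inE eqxx /tau' eqxx => ->.
rewrite (IH _ _ _ (xi + topple x t) [ffun y => u y + (y == x)]%N kappa').
- by rewrite cardfsU1 pJ.
- move=> q; rewrite !inE ffunE => /orP[/eqP->/=|/freshJ qu].
    by rewrite eqxx addn1.
  exact: leq_trans qu (leq_addr _ _).
- move=> w [JA hA].
  have Aw : path_event eta J tau h m w.
    split=> [q qJ|k km].
      rewrite JA ?inE ?qJ ?orbT// /tau'; case: eqP => // qp.
      by rewrite qp (negbTE pJ) in qJ.
    by rewrite hA ?ltnS 1?ltnW// /h' ltn_eqF.
  rewrite /= detJ//= /stab_step /= (negbTE unst) hA// /h' eqxx.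
  by have /= := JA p; rewrite !inE eqxx /tau' eqxx => ->.
(* The entries in [J] already determine the state, so [choice_law] also applies to the event with
   the larger set [J']. *)
- move=> J' tau'' JJ' tautau.
  have JsJ' : (J `<=` J')%fset by apply: fsubset_trans JJ'; exact: fsubsetU1.
  have tautau0 : {in J, tau'' =1 tau}.
    move=> q qJ; rewrite tautau ?inE ?qJ ?orbT // /tau'; case: eqP => // qp.
    by rewrite qp (negbTE pJ) in qJ.
  rewrite (_ : path_event _ _ _ _ _ =
      path_event eta J' tau'' h m `&` choice eta m @^-1` [set x]).
    rewrite (choice_law (xi := xi)) //.
      rewrite lawJ // -EFinM; congr (_%:E); rewrite /kappa'; ring.
    move=> w [JA hA] /=; rewrite detJ//; split=> // q qJ.
    by rewrite JA ?(fsubsetP JsJ')// tautau0.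
  apply/seteqP; split=> [w [JA hA]|w [[JA hA] cw]].
    split; last by rewrite /= hA// /h' eqxx.
    by split=> // k km; rewrite hA 1?ltnW // /h' ltn_eqF.
  split=> // k; rewrite ltnS leq_eqVlt => /orP[/eqP->|km].
    by rewrite /h' eqxx.
  by rewrite /h' ltn_eqF//; exact: hA.
Qed.

Lemma state_law (v0 : vertex a b) eta zeta r :
  P [set w | (state eta w r).1 = zeta] =
  (iter r config_mean (fun xi => (xi == zeta)%:R) eta)%:E.
Proof.
have [mL PL indL] := tm_instrP M.
(* At time 0 nothing has been read or chosen: [h] and [tau0] are placeholders, and the hypothesis on
   larger sets of entries is the independence of the stacks. *)
pose tau0 (p : vertex a b * nat) := ToLeft.
have := @state_path_law eta zeta r 0 (fun=> v0) tau0 eta [ffun=> 0%N] 1 fset0.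
rewrite cardfs0 expr0 !mul1r add0n => <- //.
  by congr (P _); apply/seteqP; split=> w => [Aw|[]].
move=> J' tau' _ _; rewrite (_ : path_event _ _ _ _ _ =
  [set w | forall p, p \in J' -> [set tau' p] (instr p.1 p.2 w)]).
  rewrite (indL J' (fun p => [set tau' p])).
  rewrite (eq_bigr (fun=> (3^-1)%:E)) => [|p _]; last exact: PL.
  by rewrite prodEFin big_const_seq count_predT iter_mulr_1 mul1r.
by apply/seteqP; split=> [w [JA _] p /JA|w JA] //; split=> // p /JA.
Qed.

Lemma measurable_stabilizes_to eta xi :
  measurable (stabilizes_to (M := M) eta xi).
Proof.
rewrite (_ : stabilizes_to _ _ =
  \bigcup_r [set w | [set s | stable s.1 /\ s.1 = xi] (state eta w r)]).
  by apply: bigcupT_measurable => r; exact: measurable_state.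
by apply/seteqP; split=> [w [r rE]|w [r _ rE]]; exists r.
Qed.

(** A stable [xi] is absorbing, so the events of being at [xi] after [r] steps increase to
    [stabilizes_to], and continuity from below applies. *)
Lemma stabilizes_to_cvg (v0 : vertex a b) eta xi : stable xi ->
  (iter r config_mean (fun eta => (eta == xi)%:R) eta)%:E @[r --> \oo] -->
  P (stabilizes_to (M := M) eta xi).
Proof.
move=> st; rewrite (eq_cvg _ _ (fun r => esym (state_law v0 eta xi r))).
have -> : stabilizes_to (M := M) eta xi =
    \bigcup_r [set w | (state eta w r).1 = xi].
  apply/seteqP; split=> [w [r /= [_ eq]]|w [r _ /= eq]]; exists r => //.
  by split=> //; rewrite eq.
have mE r : measurable [set w | (state eta w r).1 = xi].
  exact: (measurable_state eta r [set s | s.1 = xi]).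
apply: nondecreasing_cvg_mu => //; first exact: bigcupT_measurable.
move=> m n mn; apply/subsetPset => w /= stw.
by rewrite -(subnKC mn) stab_state_stable // stw.
Qed.

Lemma stabilizes_to_unstable eta xi : ~~ stable xi ->
  P (stabilizes_to (M := M) eta xi) = 0.
Proof.
move=> unst; rewrite (_ : stabilizes_to _ _ = set0) ?measure0//.
by rewrite -subset0 => w [r /= [st eq]]; rewrite -eq st in unst.
Qed.

End StabilizationLaw.

(** * Edge strings *)

Section EdgeStrings.
Context (R : realType) (a b : int).

Local Notation n := (`|b - a|.+2).

Definition edge_string := {ffun 'I_n -> bool}.

Definition site_index (v : vertex a b) : nat := `|val v - a|.

Lemma val_vertexP (v : vertex a b) : a <= val v <= b.
Proof. by rewrite -mem_zrange; exact: ssvalP. Qed.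

Lemma val_site v : val v = a + (site_index v)%:Z.
Proof. have := val_vertexP v; rewrite /site_index; lia. Qed.

Lemma site_index_lt v : (site_index v < `|b - a|.+1)%N.
Proof. have := val_vertexP v; rewrite /site_index; lia. Qed.

Lemma site_index_onto k : a <= b -> (k < `|b - a|.+1)%N ->
  exists v, site_index v = k.
Proof.
move=> ab kn; have zk : a + k%:Z \in zrange a b by rewrite mem_zrange; lia.
by exists (SeqSub zk); rewrite /site_index /=; lia.
Qed.

Definition left_edge v : 'I_n := inord (site_index v).
Definition right_edge v : 'I_n := inord (site_index v).+1.

Lemma left_edgeE v : left_edge v = site_index v :> nat.
Proof. by rewrite inordK // ltnW // ltnS site_index_lt. Qed.

Lemma right_edgeE v : right_edge v = (site_index v).+1 :> nat.
Proof. by rewrite inordK // ltnS site_index_lt. Qed.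

(* [config_of_string] is injective except that the all-0 and the all-1 strings
   both encode the full configuration. *)
Definition config_of_string (s : edge_string) : config a b :=
  [ffun v => 1 + (s (right_edge v) : nat)%:Z - (s (left_edge v) : nat)%:Z].

(** A particle crossing an edge leftwards turns its bit from 0 to 1, one crossing rightwards from 1
    to 0. *)
Definition topple_string (s : edge_string) (v : vertex a b) (t : instruction) :
    edge_string :=
  [ffun j => if j == left_edge v then t != ToRight
             else if j == right_edge v then t == ToLeft else s j].

Lemma unstable_string s v :
  (v \in unstable (config_of_string s)) =
  s (right_edge v) && ~~ s (left_edge v).
Proof. by rewrite inE ffunE; case: (s _); case: (s _). Qed.

Lemma topple_at (v w : vertex a b) t : topple v t w =
  if val w == val v then - ((t != ToRight) + (t != ToLeft))%N%:Z
  else if val w == val v - 1 then ((t != ToRight) : nat)%:Z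
  else if val w == val v + 1 then ((t != ToLeft) : nat)%:Z else 0.
Proof.
have [wv|wv] := eqVneq (val w) (val v).
  have n1 : (val v == val v - 1) = false by apply/negbTE; lia.
  have n2 : (val v == val v + 1) = false by apply/negbTE; lia.
  by case: t; rewrite !ffunE /= ?ffunE /= wv ?n1 ?n2 eqxx.
have [wv1|wv1] := eqVneq (val w) (val v - 1).
  have n2 : (val v - 1 == val v + 1) = false by apply/negbTE; lia.
  have n3 : (val v - 1 == val v) = false by apply/negbTE; lia.
  by case: t; rewrite !ffunE /= ?ffunE /= wv1 ?eqxx ?n2 n3.
have [wv2|wv2] := eqVneq (val w) (val v + 1); last first.
  by case: t; rewrite !ffunE /= ?ffunE /= ?(negbTE wv1) ?(negbTE wv2) (negbTE wv).
have n3 : (val v + 1 == val v) = false by apply/negbTE; lia.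
have n1 : (val v + 1 == val v - 1) = false by apply/negbTE; lia.
by case: t; rewrite !ffunE /= ?ffunE /= wv2 ?eqxx ?n1 n3.
Qed.

Lemma config_of_topple_string s v t : v \in unstable (config_of_string s) ->
  config_of_string (topple_string s v t) = config_of_string s + topple v t.
Proof.
rewrite unstable_string => /andP[sr /negbTE sl]; apply/ffunP => w.
have rl : (right_edge w == left_edge v) = (val w == val v - 1).
  by rewrite -val_eqE /= right_edgeE left_edgeE !val_site; lia.
have rr : (right_edge w == right_edge v) = (val w == val v).
  by rewrite -val_eqE /= !right_edgeE !val_site; lia.
have ll : (left_edge w == left_edge v) = (val w == val v).
  by rewrite -val_eqE /= !left_edgeE !val_site; lia.
have lr : (left_edge w == right_edge v) = (val w == val v + 1).
  by rewrite -val_eqE /= right_edgeE left_edgeE !val_site; lia.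
rewrite !ffunE topple_at rl rr ll lr.
have [wv|wv] := eqVneq (val w) (val v).
  have n1 : (val v == val v - 1) = false by apply/negbTE; lia.
  by rewrite (val_inj wv) sr sl n1; case: t.
have [wv1|wv1] := eqVneq (val w) (val v - 1).
  have -> : right_edge w = left_edge v by apply/eqP; rewrite rl wv1.
  have n2 : (val v - 1 == val v + 1) = false by apply/negbTE; lia.
  by rewrite wv1 n2 sl; case: t; case: (s _).
have [wv2|wv2] := eqVneq (val w) (val v + 1); last by rewrite addr0.
have -> : left_edge w = right_edge v by apply/eqP; rewrite lr wv2.
by rewrite sr; case: t; case: (s _).
Qed.

Definition string_mean : (edge_string -> R) -> edge_string -> R :=
  toppling_mean config_of_string topple_string.

(** [config_of_string] intertwines the two operators, so the law of the configuration can be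
    computed on strings. *)
Lemma iter_string_mean f s m :
  iter m string_mean (f \o config_of_string) s =
  iter m (@config_mean R a b) f (config_of_string s).
Proof.
elim: m s => [//|m IH] s /=; rewrite /string_mean /config_mean /toppling_mean /=.
case: ifP => _; first exact: IH.
congr (_ * _); apply: eq_bigr => v vU; congr (_ * _); apply: eq_bigr => t _.
by rewrite -/string_mean IH config_of_topple_string.
Qed.

Lemma string_meanD F G s :
  string_mean (fun s => F s + G s) s = string_mean F s + string_mean G s.
Proof.
rewrite /string_mean /toppling_mean; case: ifP => // _.
rewrite -mulrDr -big_split /=; congr (_ * _); apply: eq_bigr => v _.
by rewrite -mulrDr -big_split.
Qed.

Lemma string_meanZ c F s :
  string_mean (fun s => c * F s) s = c * string_mean F s.
Proof.
rewrite /string_mean /toppling_mean; case: ifP => // _.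
rewrite mulrCA; congr (_ * _); rewrite mulr_sumr; apply: eq_bigr => v _.
by rewrite mulrCA; congr (_ * _); rewrite mulr_sumr.
Qed.

Lemma le_string_mean F G s : (forall s, F s <= G s) ->
  string_mean F s <= string_mean G s.
Proof.
move=> FG; rewrite /string_mean /toppling_mean; case: ifP => // _.
rewrite ler_wpM2l ?invr_ge0 ?ler0n//; apply: ler_sum => v _.
by rewrite ler_wpM2l ?invr_ge0 ?ler0n//; apply: ler_sum.
Qed.

(** When every unstable vertex yields the same mean over the instructions, the random choice of the
    vertex averages out. Drift computations thus reduce to one toppling at an arbitrary unstable
    vertex. *)
Lemma string_mean_fix F s (c : R) :
  (forall x, x \in unstable (config_of_string s) ->
     3^-1 * \sum_t F (topple_string s x t) = c) ->
  ~~ stable (config_of_string s) -> string_mean F s = c.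
Proof.
move=> Fc unst; rewrite /string_mean /toppling_mean (negbTE unst).
rewrite (eq_bigr _ Fc) sumr_const -[c *+ _]mulr_natl mulrA mulVf ?mul1r //.
by rewrite pnatr_eq0 -lt0n card_unstable_gt0.
Qed.

Lemma iter_string_meanD F G m s :
  iter m string_mean (fun s => F s + G s) s =
  iter m string_mean F s + iter m string_mean G s.
Proof.
elim: m s => [//|m IH] s /=; rewrite -string_meanD.
by congr (string_mean _ s); apply/funext.
Qed.

Lemma iter_string_meanZ c F m s :
  iter m string_mean (fun s => c * F s) s = c * iter m string_mean F s.
Proof.
elim: m s => [//|m IH] s /=; rewrite -string_meanZ.
by congr (string_mean _ s); apply/funext.
Qed.

Lemma iter_string_mean_cst c m s : iter m string_mean (fun=> c) s = c.
Proof.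
elim: m s => [//|m IH] s /=; rewrite (_ : iter _ _ _ = fun=> c); last exact/funext.
have [st|unst] := boolP (stable (config_of_string s)).
  by rewrite /string_mean /toppling_mean st.
apply: string_mean_fix => // x _; by rewrite big_instruction; field.
Qed.

Lemma iter_string_mean_sum (I : Type) (r : seq I) (F : I -> edge_string -> R) m s :
  iter m string_mean (fun s => \sum_(i <- r) F i s) s =
  \sum_(i <- r) iter m string_mean (F i) s.
Proof.
elim: r => [|i r IH].
  rewrite big_nil (_ : (fun _ => _) = fun=> 0) ?iter_string_mean_cst //.
  by apply/funext => t; rewrite big_nil.
rewrite big_cons -IH -iter_string_meanD; congr (iter _ _ _ _).
by apply/funext => t; rewrite big_cons.
Qed.

Lemma le_iter_string_mean F G m s : (forall s, F s <= G s) ->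
  iter m string_mean F s <= iter m string_mean G s.
Proof. by move=> FG; elim: m s => [//|m IH] s /=; exact: le_string_mean. Qed.

Lemma site_edges_neq v : right_edge v != left_edge v.
Proof. by rewrite -val_eqE /= right_edgeE left_edgeE; lia. Qed.

Definition other_edges v : pred 'I_n :=
  [pred j | (j != left_edge v) && (j != right_edge v)].

Definition ones (s : edge_string) : R := \sum_(j < n) (s j)%:R.

Definition weight (z : R) (s : edge_string) : R :=
  \prod_(j < n) (z + (j : nat)%:R + (2 * ~~ s j)%:R).

Lemma ones_topple_string s v t :
  ones (topple_string s v t) =
  (t != ToRight)%:R + (t == ToLeft)%:R + \sum_(j | other_edges v j) (s j)%:R.
Proof.
rewrite /ones (bigD1 (left_edge v)) //= (bigD1 (right_edge v)) ?site_edges_neq //=.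
rewrite !ffunE !eqxx (negbTE (site_edges_neq v)) addrA; congr (_ + _).
apply: eq_bigr => j /andP[jl jr]; rewrite !ffunE.
by rewrite (negbTE jl) (negbTE jr).
Qed.

Lemma onesE s v : ones s =
  (s (left_edge v))%:R + (s (right_edge v))%:R
  + \sum_(j | other_edges v j) (s j)%:R.
Proof.
rewrite /ones (bigD1 (left_edge v)) //= (bigD1 (right_edge v)) ?site_edges_neq //=.
by rewrite addrA.
Qed.

Lemma weight_topple_string z s v t :
  weight z (topple_string s v t) =
  (z + (site_index v)%:R + (2 * ~~ (t != ToRight))%:R) *
  (z + (site_index v).+1%:R + (2 * ~~ (t == ToLeft))%:R) *
  \prod_(j | other_edges v j) (z + (j : nat)%:R + (2 * ~~ s j)%:R).
Proof.
rewrite /weight (bigD1 (left_edge v)) //= (bigD1 (right_edge v)) ?site_edges_neq //=.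
rewrite !ffunE !eqxx (negbTE (site_edges_neq v)) left_edgeE right_edgeE.
rewrite mulrA; congr (_ * _).
apply: eq_bigr => j /andP[jl jr]; rewrite !ffunE.
by rewrite (negbTE jl) (negbTE jr).
Qed.

Lemma weightE z s v : weight z s =
  (z + (site_index v)%:R + (2 * ~~ s (left_edge v))%:R) *
  (z + (site_index v).+1%:R + (2 * ~~ s (right_edge v))%:R) *
  \prod_(j | other_edges v j) (z + (j : nat)%:R + (2 * ~~ s j)%:R).
Proof.
rewrite /weight (bigD1 (left_edge v)) //= (bigD1 (right_edge v)) ?site_edges_neq //=.
by rewrite left_edgeE right_edgeE mulrA.
Qed.

Lemma string_mean_weight z : string_mean (weight z) = weight z.
Proof.
apply/funext => s; have [st|unst] := boolP (stable (config_of_string s)).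
  by rewrite /string_mean /toppling_mean st.
apply: string_mean_fix => // v; rewrite unstable_string => /andP[sr /negbTE sl].
rewrite big_instruction !weight_topple_string (weightE z s v) sl sr /=.
by rewrite -natr1; field.
Qed.

(** Replacing 01 by 11, 00 or 10 changes the number of ones by 1, -1 or 0, so the square gains 2/3
    on average. *)
Lemma string_mean_ones2 s :
  string_mean (fun s => ones s ^+ 2) s =
  ones s ^+ 2 + 2 / 3 * (~~ stable (config_of_string s))%:R.
Proof.
have [st|unst] := boolP (stable (config_of_string s)).
  by rewrite /string_mean /toppling_mean st mulr0 addr0.
apply: string_mean_fix => // v; rewrite unstable_string => /andP[sr /negbTE sl].
rewrite big_instruction !ones_topple_string (onesE s v) sl sr /=.
by field.
Qed.

End EdgeStrings.

(** * The law of the final string *)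

Section ExitLaw.
Context (R : realType) (a b : int).

Local Notation n := (`|b - a|.+2).

Definition threshold (k : nat) : edge_string a b := [ffun j : 'I_n => (j < k)%N].

Lemma stable_threshold k : stable (config_of_string (threshold k)).
Proof.
apply/eqP/setP => v; rewrite unstable_string inE !ffunE left_edgeE right_edgeE.
lia.
Qed.

Lemma threshold_inj : {in [pred k | (k <= n)%N] &, injective threshold}.
Proof.
suff lt_neq k l : (k < l)%N -> (l <= n)%N -> threshold k <> threshold l.
  move=> k l; rewrite !inE => kn ln eq_kl.
  case: (ltngtP k l) => // [/lt_neq|/lt_neq]; first by move=> /(_ ln)/(_ eq_kl).
  by move=> /(_ kn)/(_ (esym eq_kl)).
move=> kl ln /ffunP /(_ (Ordinal (leq_trans kl ln))).
by rewrite !ffunE /= ltnn kl.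
Qed.

(** Stability forbids the pattern 01, so the bits are nonincreasing from left to right; [k] is the
    position of the first 0. *)
Lemma stable_stringP (s : edge_string a b) : a <= b ->
  stable (config_of_string s) -> exists2 k, (k <= n)%N & s = threshold k.
Proof.
move=> ab st; have desc j : (j.+1 < n)%N -> s (inord j.+1) -> s (inord j).
  move=> jn; have [v vj] := site_index_onto ab jn.
  have /(congr1 (fun U : {set vertex a b} => v \in U)) := eqP st.
  rewrite unstable_string inE /left_edge /right_edge vj.
  by case: (s (inord j)) => //; case: (s _).
exists (find (fun j => ~~ s (inord j)) (iota 0 n)).
  by rewrite -[leqRHS](size_iota 0) find_size.
set k := find _ _; apply/ffunP => j; rewrite ffunE.
case: ltnP => [jk|kj].
  have := before_find 0%N jk; rewrite nth_iota // add0n inord_val => /negbT.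
  by rewrite negbK.
have kn : (k < n)%N by exact: leq_ltn_trans kj (ltn_ord j).
have sk : ~~ s (inord k).
  have := @nth_find _ 0%N (fun j => ~~ s (inord j)) (iota 0 n).
  by rewrite has_find size_iota kn -/k nth_iota// => ->.
rewrite -[j]inord_val; apply/negbTE.
elim: {j}(j : nat) kj (ltn_ord j) => [|j IH].
  by rewrite leqn0 => /eqP <-.
rewrite leq_eqVlt => /orP[/eqP <-//|kj] jn.
by apply: contra (IH kj (ltnW jn)); exact: desc.
Qed.

Let unst (s : edge_string a b) : R := (~~ stable (config_of_string s))%:R.

(** Dynkin's formula: the sum is the expected number of topplings during the first [m] steps. *)
Lemma iter_string_mean_ones2 m s :
  iter m (@string_mean R a b) (fun s => ones R s ^+ 2) s =
  ones R s ^+ 2 + 2 / 3 * \sum_(0 <= i < m) iter i (@string_mean R a b) unst s.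
Proof.
elim: m s => [|m IH] s; first by rewrite big_geq // mulr0 addr0.
rewrite iterSr (_ : string_mean _ = fun s => ones R s ^+ 2 + 2 / 3 * unst s).
  by rewrite iter_string_meanD iter_string_meanZ IH big_nat_recr//= mulrDr addrA.
by apply/funext => t; rewrite string_mean_ones2.
Qed.

(** There are at most n ones, so the expected number of topplings is at most 3/2 n^2. The terms of
    this convergent series tend to 0. *)
Lemma iter_string_mean_unst s :
  iter m (@string_mean R a b) unst s @[m --> \oo] --> 0.
Proof.
apply: cvg_series_cvg_0.
apply: nondecreasing_is_cvgn.
  apply/nondecreasing_seqP => m; rewrite -subr_ge0 /series /= big_nat_recr //=.
  rewrite addrAC subrr add0r -(iter_string_mean_cst 0 m s).
  by apply: le_iter_string_mean => t; exact: ler0n.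
exists (3 / 2 * n%:R ^+ 2) => _ [m _ <-].
have : iter m (@string_mean R a b) (fun s => ones R s ^+ 2) s <= n%:R ^+ 2.
  rewrite -(iter_string_mean_cst (n%:R ^+ 2) m s); apply: le_iter_string_mean => t.
  rewrite lerXn2r ?nnegrE ?ler0n ?sumr_ge0 //.
  rewrite -[n in n%:R]card_ord -sumr_const; apply: ler_sum => i _.
  by rewrite lern1 leq_b1.
rewrite iter_string_mean_ones2 /series /=.
have := sqr_ge0 (ones R s); lra.
Qed.

Definition exit (s : edge_string a b) (k : nat) : R :=
  limn (fun m => iter m (@string_mean R a b) (fun t => (t == threshold k)%:R) s).

(** Thresholds are absorbing, so the hitting probabilities increase in [m], and they are bounded by
    1. *)
Lemma cvg_exit s k :
  iter m (@string_mean R a b) (fun t => (t == threshold k)%:R) s @[m --> \oo]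
    --> exit s k.
Proof.
apply: nondecreasing_is_cvgn.
  apply/nondecreasing_seqP => m; rewrite iterSr.
  apply: le_iter_string_mean => t.
  have [->|_] := eqVneq t (threshold k).
    by rewrite /string_mean /toppling_mean stable_threshold eqxx.
  rewrite -[leLHS](iter_string_mean_cst 0 1 t) /=.
  by apply: le_string_mean => u; exact: ler0n.
exists 1 => _ [m _ <-]; rewrite -[leRHS](iter_string_mean_cst 1 m s).
by apply: le_iter_string_mean => t; rewrite lern1 leq_b1.
Qed.

Lemma cvg_string_mean (F : edge_string a b -> R) s : a <= b ->
  iter m (@string_mean R a b) F s @[m --> \oo] -->
    \sum_(k < n.+1) F (threshold k) * exit s k.
Proof.
move=> ab; pose C := \sum_t `|F t|.
(* [D] vanishes on stable strings, so its iterates are bounded by a multiple of the probability of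
   still being unstable. *)
pose D t := F t - \sum_(k < n.+1) F (threshold k) * (t == threshold k)%:R.
have Dle t : `|D t| <= C * unst t.
  rewrite /D /unst; have [st|nst] := boolP (stable _).
    have [k0 k0n tk0] := stable_stringP ab st.
    rewrite mulr0 normr_le0 subr_eq0 (bigD1 (Ordinal (k0n : (k0 < n.+1)%N))) //=.
    rewrite {2}tk0 eqxx mulr1 -tk0 big1 ?addr0 // => k kk0.
    rewrite tk0; have [/threshold_inj|] := eqVneq; rewrite ?mulr0 // !inE.
    move=> /(_ k0n (ltn_ord k)) eq_k0.
    by move: kk0; rewrite -val_eqE /= -eq_k0 eqxx.
  rewrite big1 => [|k _]; last first.
    have [tk|] := eqVneq t; last by rewrite mulr0.
    by rewrite tk stable_threshold in nst.
  rewrite subr0 mulr1 /C (bigD1 t) //= lerDl.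
  by apply: sumr_ge0 => u _; exact: normr_ge0.
have D0 : iter m (@string_mean R a b) D s @[m --> \oo] --> 0.
  have Cunst : C * iter m (@string_mean R a b) unst s @[m --> \oo] --> 0.
    by rewrite -(mulr0 C); apply: cvgMl_tmp; exact: iter_string_mean_unst.
  apply: (@squeeze_cvgr _ _ _ _ (fun m => - (C * iter m (@string_mean R a b) unst s))
    (fun m => C * iter m (@string_mean R a b) unst s)) => //.
    apply: nearW => m; rewrite -mulNr -!iter_string_meanZ.
    by apply/andP; split; apply: le_iter_string_mean => t;
      have := Dle t; rewrite ler_norml ?mulNr => /andP[].
  by rewrite -oppr0; exact: cvgN.
have FD m : iter m (@string_mean R a b) F s = iter m (@string_mean R a b) D s +
    \sum_(k < n.+1) F (threshold k) *
      iter m (@string_mean R a b) (fun t => (t == threshold k)%:R) s.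
  under eq_bigr do rewrite -iter_string_meanZ.
  rewrite -iter_string_mean_sum -iter_string_meanD; congr (iter m _ _ s).
  by apply/funext => t; rewrite /D subrK.
rewrite (eq_cvg _ _ FD) -(add0r (\sum_(k < n.+1) F (threshold k) * exit s k)).
apply: cvgD => //; apply: cvg_big => [|k _]; first exact: add_continuous.
by apply: cvgMl_tmp; exact: cvg_exit.
Qed.

(** Optional stopping: the iterates are constant and therefore equal to their limit. *)
Lemma exit_martingale (F : edge_string a b -> R) s : a <= b ->
  string_mean F = F -> F s = \sum_(k < n.+1) F (threshold k) * exit s k.
Proof.
move=> ab QF; have iterF m : iter m (@string_mean R a b) F s = F s.
  by elim: m s => //= m IH s; rewrite (_ : iter _ _ _ = F) ?QF //; exact/funext.
have := @cvg_string_mean F s ab; rewrite (eq_cvg _ _ iterF).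
exact: cvg_unique (cvg_cst _).
Qed.

Lemma sum_exit s : a <= b -> \sum_(k < n.+1) exit s k = 1.
Proof.
move=> ab; rewrite (exit_martingale (F := fun=> 1) s ab); last first.
  by apply/funext => t; exact: (iter_string_mean_cst 1 1 t).
by apply: eq_bigr => k _; rewrite mul1r.
Qed.

(** Several thresholds may encode [xi]: there are two for the full configuration, which is why a sum
    appears. *)
Lemma stabilizes_to_exit (M : toppling_model R a b) s xi : a <= b ->
  tm_prob M (stabilizes_to (M := M) (config_of_string s) xi) =
  (\sum_(k < n.+1) (config_of_string (threshold k) == xi)%:R * exit s k)%:E.
Proof.
move=> ab; have [st|nst] := boolP (stable xi); last first.
  rewrite stabilizes_to_unstable // big1 // => k _.
  have [eq|] := eqVneq; last by rewrite mul0r.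
  by rewrite -eq stable_threshold in nst.
have [v0 _] := @site_index_onto a b 0 ab isT.
have cvgP := @stabilizes_to_cvg _ _ _ M v0 (config_of_string s) xi st.
apply: (cvg_unique (@ereal_hausdorff R) cvgP) => {cvgP} /=.
apply: cvg_EFin; first exact: nearW.
have := @cvg_string_mean (fun t => (config_of_string t == xi)%:R) s ab.
by rewrite (eq_cvg _ _ (fun m => iter_string_mean (fun eta => (eta == xi)%:R) s m)).
Qed.

End ExitLaw.

(** * Final law after adding a particle at a fixed vertex *)

Section AveragedExit.
Context (R : realType) (a b : int).

Local Notation n := (`|b - a|.+2).

(* A string for [threshold k] with a particle added at the vertex on the left of
   edge [x]; at the hole itself ([k = x]) the all-0 string is chosen. *)
Definition loaded (x k : nat) : edge_string a b :=
  [ffun j : 'I_n => if (k < x)%N then (j < k)%N || (x <= j)%N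
                    else (x <= j < k)%N].

Lemma config_of_loaded (v : vertex a b) k :
  config_of_string (loaded (site_index v).+1 k) =
  config_of_string (threshold a b k) + delta a b (val v).
Proof.
apply/ffunP => w; rewrite !ffunE left_edgeE right_edgeE.
have -> : (val w == val v) = (site_index w == site_index v).
  by rewrite !val_site; lia.
by case: ltnP => ?; lia.
Qed.

(* The polynomials are triangular at the points z = 0, -1, ..., -n: at z = -k
   those of the thresholds l > k vanish and that of k does not. *)
Lemma weight_independent (e : nat -> R) :
  (forall z, 0 < z -> \sum_(k < n.+1) e k * weight z (threshold a b k) = 0) ->
  forall k, (k <= n)%N -> e k = 0.
Proof.
move=> e0.
pose W (s : edge_string a b) : {poly R} :=
  \prod_(j < n) ('X + ((j : nat)%:R + (2 * ~~ s j)%:R)%:P).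
have WE z s : (W s).[z] = weight z s.
  rewrite /W horner_prod; apply: eq_bigr => j _.
  by rewrite hornerD hornerX hornerC addrA.
pose p := \sum_(k < n.+1) e k *: W (threshold a b k).
have pE z : p.[z] = \sum_(k < n.+1) e k * weight z (threshold a b k).
  by rewrite /p horner_sum; apply: eq_bigr => k _; rewrite hornerZ WE.
have p0 : p = 0.
  (* The points 1, ..., [size p] are too many roots for a nonzero polynomial of this size. Hence the
     identity extends to negative [z]. *)
  apply: (@roots_geq_poly_eq0 _ _ [seq i.+1%:R | i <- iota 0 (size p)]).
  - by apply/allP => _ /mapP[i _ ->]; rewrite rootE pE e0 // ltr0n.
  - by rewrite map_inj_uniq ?iota_uniq // => i j /eqP; rewrite eqr_nat => /eqP[].
  - by rewrite size_map size_iota.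
have {}e0 z : \sum_(k < n.+1) e k * weight z (threshold a b k) = 0.
  by rewrite -pE p0 horner0.
elim/ltn_ind => k IH kn.
have := e0 (- k%:R); rewrite (bigD1 (Ordinal (kn : (k < n.+1)%N))) //= big1.
  rewrite addr0 => /eqP; rewrite mulf_eq0 => /orP[/eqP//|].
  rewrite /weight prodf_seq_eq0 => /hasP[j _]; rewrite /= ffunE => /eqP w0.
  exfalso; move: w0; case: ltnP => jk; rewrite /= ?muln0 ?muln1.
    move=> w0; have : (j : nat)%:R = k%:R :> R by lra.
    by move/eqP; rewrite eqr_nat => /eqP; lia.
  move=> w0; have : (j : nat)%:R + 2 = k%:R :> R by lra.
  by rewrite -natrD => /eqP; rewrite eqr_nat => /eqP; lia.
(* Terms with l < k vanish by induction. For l > k the bit on edge k is 1, and its factor z + k is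
   zero. *)
move=> l lk; have [l_lt|] := ltnP l k; first by rewrite IH ?mul0r // -ltnS.
rewrite leq_eqVlt => /orP[/eqP kl|kl]; first by move: lk; rewrite -val_eqE /= kl eqxx.
have kn' : (k < n)%N by exact: leq_trans kl (ltn_ord l).
rewrite /weight (bigD1 (Ordinal kn')) //= ffunE /= kl muln0 addr0 addNr.
by rewrite mul0r mulr0.
Qed.

Section WeightBlocks.
Variables (z : R) (z_gt0 : 0 < z).

(* (z + j + 2) / (z + j) = g j / g (j + 1), so a block of zeros telescopes. *)
Let g (k : nat) : R := ((z + k%:R) * (z + k.+1%:R))^-1.
Let base : R := \prod_(0 <= j < n) (z + j%:R).

Let zD_neq0 k : z + k%:R != 0.
Proof. by rewrite gt_eqF // ltr_pwDl. Qed.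

Let g_neq0 k : g k != 0.
Proof. by rewrite invr_eq0 mulf_neq0. Qed.

Let prod_g p q : (p <= q)%N -> \prod_(p <= j < q) (g j / g j.+1) = g p / g q.
Proof.
elim: q => [|q IH]; first by rewrite leqn0 => /eqP->; rewrite big_geq ?divff.
rewrite leq_eqVlt ltnS => /orP[/eqP->|pq]; first by rewrite big_geq ?divff.
by rewrite big_nat_recr //= IH // mulrA divfK.
Qed.

(** Partial fractions: g k is the difference of the inverses of z + k and z + k + 1. *)
Let sum_g p q : (p <= q)%N ->
  \sum_(p <= j < q) g j = (z + p%:R)^-1 - (z + q%:R)^-1.
Proof.
elim: q => [|q IH]; first by rewrite leqn0 => /eqP->; rewrite big_geq ?subrr.
rewrite leq_eqVlt ltnS => /orP[/eqP->|pq]; first by rewrite big_geq ?subrr.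
rewrite big_nat_recr //= IH // /g.
have := zD_neq0 q; have := zD_neq0 q.+1; have := zD_neq0 p.
rewrite -natr1 => zp zq1 zq; field.
by rewrite ?zp ?zq ?zq1.
Qed.

Let weight_ratio (f : nat -> bool) :
  weight z ([ffun j : 'I_n => f j] : edge_string a b) =
  base * \prod_(0 <= j < n) (if f j then 1 else g j / g j.+1).
Proof.
rewrite /base -big_split /= [RHS]big_mkord; apply: eq_bigr => j _.
rewrite ffunE; case: ifP => _ /=; first by rewrite muln0 addr0 mulr1.
rewrite muln1 /g invrK.
have := zD_neq0 j; have := zD_neq0 j.+1; rewrite -[j.+2%:R]natr1 -natr1 => zj1 zj.
field. by rewrite zj zj1.
Qed.

Let prod_ones (f : nat -> bool) p q : (forall j, (p <= j < q)%N -> f j) ->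
  \prod_(p <= j < q) (if f j then 1 else g j / g j.+1) = 1.
Proof. by move=> fT; rewrite big_nat big1 // => j /fT ->. Qed.

Let prod_zeros (f : nat -> bool) p q : (p <= q)%N ->
  (forall j, (p <= j < q)%N -> ~~ f j) ->
  \prod_(p <= j < q) (if f j then 1 else g j / g j.+1) = g p / g q.
Proof.
move=> pq fF; rewrite -prod_g // [LHS]big_nat [RHS]big_nat.
by apply: eq_bigr => j /fF /negbTE ->.
Qed.

Lemma weight_threshold k : (k <= n)%N ->
  weight z (threshold a b k) = base * (g k / g n).
Proof.
move=> kn; rewrite (weight_ratio (fun j => (j < k)%N)) (big_cat_nat (n := k)) //=.
rewrite prod_ones ?prod_zeros ?mul1r // => j; lia.
Qed.

Lemma weight_loaded_lt x k : (k < x <= n)%N ->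
  weight z (loaded x k) = base * (g k / g x).
Proof.
move=> /andP[kx xn]; rewrite /loaded kx.
rewrite (weight_ratio (fun j => (j < k)%N || (x <= j)%N)).
rewrite (big_cat_nat (n := x)) //= (big_cat_nat (n := k) (p := x)) //=;
  last exact: ltnW.
rewrite (@prod_ones _ 0 k) ?(@prod_zeros _ k x) ?(@prod_ones _ x n) ?mul1r ?mulr1 //;
  by move=> *; lia.
Qed.

(** The zeros form two blocks, before [x] and from [k] on, and each telescopes to one quotient. *)
Lemma weight_loaded_ge x k : (x <= k <= n)%N ->
  weight z (loaded x k) = base * (g 0 / g x * (g k / g n)).
Proof.
move=> /andP[xk kn]; rewrite /loaded ltnNge xk /=.
rewrite (weight_ratio (fun j => (x <= j < k)%N)).
rewrite (big_cat_nat (n := k)) //= (big_cat_nat (n := x) (p := k)) //=.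
rewrite (@prod_zeros _ 0 x) ?(@prod_ones _ x k) ?(@prod_zeros _ k n) ?mulr1 //;
  by move=> *; lia.
Qed.

Lemma sum_endpoints (c d e : R) (F : nat -> R) :
  \sum_(k < n.+1) (c + d * (k == 0 :> nat)%:R + e * (k == n :> nat)%:R) * F k =
  c * \sum_(0 <= k < n.+1) F k + d * F 0 + e * F n.
Proof.
under eq_bigr do rewrite !mulrDl.
rewrite !big_split /= -mulr_sumr big_mkord; congr (_ + _ + _).
  rewrite (bigD1 ord0) //= ?eqxx mulr1 big1 ?addr0 // => k k0.
  by rewrite (negbTE (k0 : (k : nat) != 0%N)) mulr0 mul0r.
rewrite (bigD1 ord_max) //= ?eqxx mulr1 big1 ?addr0 // => k kn.
by rewrite (negbTE (kn : (k : nat) != n)) mulr0 mul0r.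
Qed.

(* The claimed distribution, lifted to thresholds: the mass of the full
   configuration is shared equally between k = 0 and k = n.  After a particle is
   added the share depends on the vertex, as [exit_level_law] shows. *)
Definition level_law (k : nat) : R :=
  (2 * n%:R)^-1 + (n%:R - 1) / (4 * n%:R) * (k == 0)%:R
                + (n%:R - 1) / (4 * n%:R) * (k == n)%:R.

Definition exit_level_law (x k : nat) : R :=
  (2 * n%:R)^-1 + x%:R / (2 * n%:R) * (k == 0)%:R
                + (n%:R - x%:R - 1) / (2 * n%:R) * (k == n)%:R.

(** Both sums telescope, which leaves an identity between rational functions of z, n and x. *)
Lemma average_weight_loaded x : (0 < x <= n)%N ->
  \sum_(k < n.+1) level_law k * weight z (loaded x k) =
  \sum_(k < n.+1) exit_level_law x k * weight z (threshold a b k).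
Proof.
move=> /andP[x0 xn]; have xn1 : (x <= n.+1)%N by exact: leqW.
rewrite (sum_endpoints _ _ _ (fun k => weight z (loaded x k))).
rewrite (sum_endpoints _ _ _ (fun k => weight z (threshold a b k))).
rewrite (@weight_loaded_lt x 0) ?x0 // (@weight_loaded_ge x n) ?xn ?leqnn //.
rewrite (@weight_threshold 0) // (@weight_threshold n) //.
(* The shape of [loaded x k] changes at k = x. *)
rewrite (big_cat_nat (n := x)) //=.
have -> : \sum_(0 <= k < x) weight z (loaded x k) =
    base * ((z + 0%:R)^-1 - (z + x%:R)^-1) / g x.
  rewrite -sum_g // mulr_sumr mulr_suml big_nat [RHS]big_nat.
  by apply: eq_bigr => k /andP[_ kx]; rewrite weight_loaded_lt ?kx ?mulrA.
have -> : \sum_(x <= k < n.+1) weight z (loaded x k) =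
    base * (g 0 / g x / g n) * ((z + x%:R)^-1 - (z + n.+1%:R)^-1).
  rewrite -sum_g // mulr_sumr big_nat [RHS]big_nat.
  apply: eq_bigr => k /andP[xk kn]; rewrite weight_loaded_ge ?xk -1?ltnS ?kn //.
  by rewrite -!mulrA (mulrC (g n)^-1).
have -> : \sum_(0 <= k < n.+1) weight z (threshold a b k) =
    base / g n * ((z + 0%:R)^-1 - (z + n.+1%:R)^-1).
  rewrite -sum_g // mulr_sumr big_nat [RHS]big_nat.
  apply: eq_bigr => k /andP[_ kn]; rewrite weight_threshold -1?ltnS ?kn //.
  by rewrite -!mulrA (mulrC (g n)^-1).
have n0 : n%:R != 0 :> R by rewrite pnatr_eq0.
have := zD_neq0 n; have := zD_neq0 n.+1; have := zD_neq0 x; have := zD_neq0 x.+1.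
have := zD_neq0 1; have := zD_neq0 0.
rewrite /g -[n.+1%:R]natr1 -[x.+1%:R]natr1 addr0.
move: base (n%:R : R) n0 (x%:R : R) => B N N0 X z0 z1 zx1 zx zn1 zn.
field.
by rewrite N0 z0 z1 zx zx1 zn zn1.
Qed.

End WeightBlocks.

(** By optional stopping, the left-hand sides are the coefficients of the averaged weight of the
    loaded strings in terms of threshold weights. [average_weight_loaded] gives a second expansion,
    and linear independence identifies the two. *)
Lemma exit_loaded x k : a <= b -> (0 < x <= n)%N -> (k <= n)%N ->
  \sum_(l < n.+1) level_law l * exit R (loaded x l) k = exit_level_law x k.
Proof.
move=> ab xn kn; apply/eqP; rewrite -subr_eq0; apply/eqP; move: k kn.
apply: (weight_independent (e := fun k => _ - exit_level_law x k)) => z z0.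
under eq_bigr do rewrite mulrBl.
rewrite sumrB -average_weight_loaded //; apply/eqP; rewrite subr_eq0; apply/eqP.
under eq_bigr do rewrite mulr_suml.
rewrite exchange_big /=; apply: eq_bigr => l _.
rewrite (exit_martingale (F := weight z) (loaded x l) ab) ?string_mean_weight //.
rewrite mulr_sumr.
by apply: eq_bigr => k _; ring.
Qed.

End AveragedExit.

Lemma esum_support (R : realType) (T : choiceType) (X : {fset T})
    (f : T -> \bar R) : (forall x, 0 <= f x)%E ->
  (forall x, x \notin X -> f x = 0%E) ->
  (\esum_(x in setT) f x = \sum_(x <- X) f x)%E.
Proof.
move=> f0 fX; transitivity (\esum_(x in [set` X]) f x)%E.
  rewrite [RHS]esum_mkcond; apply: eq_esum => x _.
  by case: ifPn => //; rewrite mem_setE => /fX.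
rewrite esum_fset //; first by rewrite fsbig_finite //= set_fsetK.
Qed.

(** * The stationary distribution *)

Section StationaryLaw.
Context (R : realType) (a b : int).
Hypothesis ab : a <= b.

Local Notation n := (`|b - a|.+2).
Local Notation recurrent k := (config_of_string (threshold a b k)).

(** For k = 0 and k = n the hole would sit at a - 1 and b + 1, where [delta] is zero. *)
Lemma config_of_threshold k : recurrent k = full a b - delta a b (a + k%:Z - 1).
Proof.
apply/ffunP => v; rewrite !ffunE left_edgeE right_edgeE.
have -> : (val v == a + k%:Z - 1) = ((site_index v).+1 == k).
  by rewrite val_site; lia.
lia.
Qed.

Lemma delta_outside j : ~~ (a <= j <= b) -> delta a b j = 0.
Proof.
move=> jab; apply/ffunP => v; rewrite !ffunE; have := val_vertexP v.
by case: eqP => // ->; rewrite (negbTE jab).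
Qed.

Lemma recurrent0 : recurrent 0 = full a b.
Proof. by rewrite config_of_threshold delta_outside ?subr0//; lia. Qed.

Lemma recurrentn : recurrent n = full a b.
Proof. by rewrite config_of_threshold delta_outside ?subr0//; lia. Qed.

Lemma hole_neq_full j : a <= j <= b -> full a b - delta a b j != full a b.
Proof.
move=> jab; have zj : j \in zrange a b by rewrite mem_zrange.
apply/eqP => /ffunP /(_ (SeqSub zj)); rewrite !ffunE /= eqxx; lia.
Qed.

Lemma hole_inj i j : a <= j <= b ->
  (full a b - delta a b i == full a b - delta a b j) = (i == j).
Proof.
move=> jab; have zj : j \in zrange a b by rewrite mem_zrange.
apply/eqP/eqP => [|-> //] /ffunP /(_ (SeqSub zj)); rewrite !ffunE /= eqxx.
by case: eqP => // _; lia.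
Qed.

Definition law (xi : config a b) : R :=
  \sum_(k < n.+1) level_law R a b k * (recurrent k == xi)%:R.

Let n_neq0 : n%:R != 0 :> R.
Proof. by rewrite pnatr_eq0. Qed.

Lemma level_law_ge0 k : 0 <= level_law R a b k.
Proof.
have n1 : 1 <= n%:R :> R by rewrite ler1n.
by rewrite /level_law !addr_ge0 ?mulr_ge0 ?invr_ge0 ?mulr_ge0 ?ler0n ?subr_ge0.
Qed.

Lemma sum_level_law : \sum_(k < n.+1) level_law R a b k = 1.
Proof.
under eq_bigr do rewrite -[level_law _ _ _ _]mulr1.
rewrite (sum_endpoints a b _ _ _ (fun=> 1)) sumr_const_nat subn0 -[n.+1%:R]natr1.
by field.
Qed.

Lemma law_full : law (full a b) = 1 / 2 + 1 / (2 * n%:R).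
Proof.
transitivity (level_law R a b 0 + level_law R a b n).
  rewrite /law big_ord_recl /= recurrent0 eqxx mulr1 big_ord_recr /= recurrentn.
  rewrite eqxx mulr1 big1 ?add0r // => k _.
  rewrite config_of_threshold (negbTE (hole_neq_full _)) ?mulr0 //.
  have := ltn_ord k; rewrite /bump /=; lia.
by rewrite /level_law !eqxx /=; field.
Qed.

Lemma law_hole j : a <= j <= b -> law (full a b - delta a b j) = 1 / (2 * n%:R).
Proof.
move=> jab; have kn : (`|j - a|.+1 < n.+1)%N by lia.
rewrite /law (bigD1 (Ordinal kn)) //= config_of_threshold hole_inj //.
rewrite (_ : _ == j); last by lia.
rewrite big1 => [|k kj]; last first.
  rewrite config_of_threshold hole_inj // (_ : (_ == _) = false) ?mulr0 //.
  by move: kj; rewrite -val_eqE /=; lia.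
rewrite /level_law /= (_ : (_ == n)= false) ; last by lia.
by rewrite !mulr0 !addr0 mulr1 div1r.
Qed.

Lemma esum_law (f : config a b -> \bar R) : (forall eta, 0 <= f eta)%E ->
  (\esum_(eta in setT) ((law eta)%:E * f eta) =
   \sum_(k < n.+1) (level_law R a b k)%:E * f (recurrent k))%E.
Proof.
move=> f0.
transitivity (\esum_(eta in setT) \sum_(k < n.+1)
   ((level_law R a b k * (recurrent k == eta)%:R)%:E * f eta))%E.
  apply: eq_esum => eta _; rewrite /law -sumEFin ge0_sume_distrl // => k _.
  by rewrite lee_fin mulr_ge0 ?level_law_ge0 ?ler0n.
rewrite esum_sum => [|eta k _ _]; last first.
  by rewrite mule_ge0 // lee_fin mulr_ge0 ?level_law_ge0 ?ler0n.
apply: eq_bigr => k _; rewrite (esum_support (X := [fset recurrent k]%fset)).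
- by rewrite big_seq_fset1 eqxx mulr1.
- by move=> eta; rewrite mule_ge0 // lee_fin mulr_ge0 ?level_law_ge0 ?ler0n.
- by move=> eta; rewrite inE eq_sym => /negbTE ->; rewrite mulr0 mul0e.
Qed.

Context (M : toppling_model R a b).

Local Notation P := (tm_prob M).

Lemma vertex_card_gt0 : (0 < #|{: vertex a b}|)%N.
Proof. by have [v _] := @site_index_onto a b 0 ab isT; apply/card_gt0P; exists v. Qed.

Definition step_law (eta xi : config a b) : R :=
  #|{: vertex a b}|%:R^-1 *
  \sum_(x : vertex a b)
    fine (P (stabilizes_to (M := M) (eta + delta a b (val x)) xi)).

Lemma fine_stabilizes_toK eta xi :
  (fine (P (stabilizes_to (M := M) eta xi)))%:E = P (stabilizes_to (M := M) eta xi).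
Proof.
by rewrite fineK // fin_num_measure //; exact: measurable_stabilizes_to.
Qed.

Lemma step_lawE eta xi : transition M eta xi = (step_law eta xi)%:E.
Proof.
rewrite /transition /step_law mulr_sumr -sumEFin; apply: eq_bigr => x _.
by rewrite EFinM fine_stabilizes_toK.
Qed.

Lemma step_law_ge0 eta xi : 0 <= step_law eta xi.
Proof.
rewrite mulr_ge0 ?invr_ge0 ?ler0n //; apply: sumr_ge0 => x _.
exact/fine_ge0/measure_ge0.
Qed.

(** If the added particle causes no instability, the outcome is certain once [x] is selected. *)
Lemma step_law_add eta (x : vertex a b) : stable (eta + delta a b (val x)) ->
  0 < step_law eta (eta + delta a b (val x)).
Proof.
move=> st; rewrite mulr_gt0 ?invr_gt0 ?ltr0n ?vertex_card_gt0 //.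
rewrite (bigD1 x) //= ltr_pwDl //; last first.
  by apply: sumr_ge0 => y _; exact/fine_ge0/measure_ge0.
rewrite (_ : stabilizes_to _ _ = setT) ?probability_setT //.
by apply/seteqP; split=> // w _; exists 0%N.
Qed.

Lemma step_law_recurrent k xi :
  step_law (recurrent k) xi = #|{: vertex a b}|%:R^-1 *
    \sum_(x : vertex a b) \sum_(l < n.+1)
      (recurrent l == xi)%:R * exit R (loaded a b (site_index x).+1 k) l.
Proof.
congr (_ * _); apply: eq_bigr => x _.
by rewrite -config_of_loaded stabilizes_to_exit.
Qed.

(** The two laws share the excess mass differently between k = 0 and k = n. Its total is the same,
    and both endpoints encode the full configuration. *)
Lemma sum_exit_level_law x (F : config a b -> R) :
  \sum_(l < n.+1) F (recurrent l) * exit_level_law R a b x l =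
  \sum_(l < n.+1) F (recurrent l) * level_law R a b l.
Proof.
under eq_bigr do rewrite mulrC; under [RHS]eq_bigr do rewrite mulrC.
rewrite (sum_endpoints a b _ _ _ (fun l => F (recurrent l))).
rewrite (sum_endpoints a b _ _ _ (fun l => F (recurrent l))).
by rewrite recurrent0 recurrentn; field.
Qed.

(** Invariance holds for each vertex [x] separately and is then averaged over [x]. *)
Lemma law_step xi :
  \sum_(k < n.+1) level_law R a b k * step_law (recurrent k) xi = law xi.
Proof.
have c0 : #|{: vertex a b}|%:R != 0 :> R.
  by rewrite pnatr_eq0 -lt0n vertex_card_gt0.
apply: (mulfI c0); rewrite mulr_sumr mulr_natl -[RHS]sumr_const.
under eq_bigr do rewrite step_law_recurrent mulrCA mulVKf // mulr_sumr.
rewrite exchange_big /=; apply: eq_bigr => x _.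
transitivity (\sum_(l < n.+1) (recurrent l == xi)%:R *
    exit_level_law R a b (site_index x).+1 l); last first.
  by rewrite (sum_exit_level_law _ (fun eta => (eta == xi)%:R)) /law;
     under eq_bigr do rewrite mulrC.
under eq_bigr do rewrite mulr_sumr.
rewrite exchange_big /=; apply: eq_bigr => l _.
have xn : (0 < (site_index x).+1 <= n)%N by exact: ltnW (site_index_lt x).
rewrite -(exit_loaded R ab xn (ltn_ord l)).
by rewrite mulr_sumr; apply: eq_bigr => k _; ring.
Qed.

Lemma stationary_law : stationary M law.
Proof.
split.
- move=> eta; apply: sumr_ge0 => k _.
  by rewrite mulr_ge0 ?level_law_ge0 ?ler0n.
- move=> eta nst; apply: big1 => k _; have [eq|] := eqVneq; last by rewrite mulr0.
  by rewrite -eq stable_threshold in nst.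
- have := @esum_law (fun=> 1%E) (fun=> lee01).
  under eq_esum do rewrite mule1.
  move=> ->; under eq_bigr do rewrite mule1.
  by rewrite sumEFin sum_level_law.
- move=> xi; under eq_esum do rewrite step_lawE.
  rewrite (esum_law (f := fun eta => (step_law eta xi)%:E)); last first.
    by move=> eta; rewrite lee_fin step_law_ge0.
  under eq_bigr do rewrite -EFinM.
  by rewrite sumEFin law_step.
Qed.

End StationaryLaw.

(** * Uniqueness *)

Section Uniqueness.
Context (R : realType) (a b : int).
Hypothesis ab : a <= b.
Context (M : toppling_model R a b).

Local Notation n := (`|b - a|.+2).
Local Notation recurrent k := (config_of_string (threshold a b k)).
Local Notation step := (step_law M).

Definition recurrents : {fset config a b} :=
  [fset recurrent (k : nat) | k : 'I_n.+1 in 'I_n.+1]%fset.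

Lemma mem_recurrent k : (k <= n)%N -> recurrent k \in recurrents.
Proof. by move=> kn; apply/imfsetP; exists (Ordinal (kn : (k < n.+1)%N)). Qed.

Lemma recurrentsP xi : reflect (exists2 k, (k <= n)%N & xi = recurrent k)
  (xi \in recurrents).
Proof.
apply: (iffP idP) => [/imfsetP[/= k _ ->]|[k kn ->]]; last exact: mem_recurrent.
by exists k; rewrite // -ltnS.
Qed.

Lemma full_recurrents : full a b \in recurrents.
Proof. by rewrite -recurrent0 // mem_recurrent. Qed.

(** The recurrent class is closed: every final string is a threshold and the exit probabilities sum
    to 1. *)
Lemma sum_step_recurrent eta : eta \in recurrents ->
  \sum_(xi <- recurrents) step eta xi = 1.
Proof.
move=> /recurrentsP[k kn ->].
have c0 : #|{: vertex a b}|%:R != 0 :> R.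
  by rewrite pnatr_eq0 -lt0n vertex_card_gt0.
under eq_bigr do rewrite step_law_recurrent //.
rewrite -mulr_sumr exchange_big /= (eq_bigr (fun=> 1)) => [|x _].
  by rewrite sumr_const mulVf.
rewrite exchange_big /= -[RHS](sum_exit R (loaded a b (site_index x).+1 k) ab).
apply: eq_bigr => l _; rewrite -mulr_suml.
have lR : recurrent l \in recurrents by apply: mem_recurrent; rewrite -ltnS.
rewrite (bigD1_seq (recurrent l)) ?fset_uniq //= eqxx big1 ?addr0 ?mul1r //.
by move=> xi; rewrite eq_sym => /negbTE ->.
Qed.

Variables (mu : config a b -> R) (mu_st : stationary M mu).

Let mu_ge0 eta : 0 <= mu eta.
Proof. by case: mu_st. Qed.

Lemma stationary_ge (X : {fset config a b}) xi :
  \sum_(eta <- X) mu eta * step eta xi <= mu xi.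
Proof.
have [_ _ _ muE] := mu_st.
rewrite -lee_fin muE -sumEFin; apply: esum_ge.
exists [set` X] => //.
rewrite fsbig_finite //= set_fsetK; under [leRHS]eq_bigr do rewrite step_lawE //.
by [].
Qed.

(* The recurrent class is closed, so any inflow would strictly increase its
   mass. *)
Lemma escape_recurrents eta xi : eta \notin recurrents -> xi \in recurrents ->
  mu eta * step eta xi = 0.
Proof.
move=> etaR xiR.
have : \sum_(xi <- recurrents) \sum_(zeta <- (eta |` recurrents)%fset)
    mu zeta * step zeta xi <= \sum_(xi <- recurrents) mu xi.
  by apply: ler_sum => zeta _; exact: stationary_ge.
rewrite exchange_big /= big_fsetU1 //= -mulr_sumr.
(* The contribution of the recurrent class cancels the right-hand side, so the inflow from [eta] is
   at most 0. *)
under [X in _ + X]eq_big_seq => zeta zR do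
  rewrite -mulr_sumr sum_step_recurrent // mulr1.
rewrite gerDr mulr_sumr (bigD1_seq xi) //= => le0.
apply/eqP; rewrite eq_le mulr_ge0 ?step_law_ge0 // andbT.
apply: le_trans le0; rewrite lerDl; apply: sumr_ge0 => zeta _.
by rewrite mulr_ge0 ?step_law_ge0.
Qed.

Lemma stable_le1 (eta : config a b) (v : vertex a b) : stable eta -> eta v <= 1.
Proof.
move=> /eqP /(congr1 (fun U : {set vertex a b} => v \in U)); rewrite !inE; lia.
Qed.

Lemma exists_hole (eta : config a b) : stable eta -> eta != full a b ->
  exists v, eta v <= 0 /\ stable (eta + delta a b (val v)).
Proof.
move=> st; rewrite -[_ != _]/(~~ _) => neq.
have [v vle] : exists v, eta v <= 0.
  apply: contrapT => /forallNP nv; move/eqP: neq; apply; apply/ffunP => v.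
  rewrite ffunE; have := stable_le1 v st; have /negP := nv v.
  by move: (eta v) => z; lia.
exists v; split=> //; apply/eqP/setP => w; rewrite !inE !ffunE.
have [/val_inj ->|_] := eqVneq (val w) (val v).
  by move: (eta v) vle => z; lia.
by have := stable_le1 w st; move: (eta w) => z; lia.
Qed.

(** Induction on the number of missing particles. Filling a hole has positive probability and leads
    either into the recurrent class, which receives no inflow, or to a configuration of zero mass by
    induction. *)
Lemma stationary_support eta : eta \notin recurrents -> mu eta = 0.
Proof.
have [mu0 nst0 _ _] := mu_st.
have [st|/nst0 //] := boolP (stable eta).
pose deficit (xi : config a b) : int := \sum_(v : vertex a b) (1 - xi v).
have [d] := ubnP `|deficit eta|%N.
elim: d eta st => // d IH eta st dlt etaR.
have [|v [v0 st']] := exists_hole st.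
  by apply: contraNneq etaR => ->; exact: full_recurrents.
have pos := step_law_add ab M st'.
have [xiR|xiR] := boolP (eta + delta a b (val v) \in recurrents).
  have /eqP := escape_recurrents etaR xiR.
  by rewrite mulf_eq0 (gt_eqF pos) orbF => /eqP.
have deficit_ge0 xi : stable xi -> 0 <= deficit xi.
  by move=> sxi; apply: sumr_ge0 => w _; have := stable_le1 w sxi; lia.
have deficitD : deficit (eta + delta a b (val v)) = deficit eta - 1.
  rewrite /deficit (bigD1 v) //= [in RHS](bigD1 v) //= !ffunE eqxx.
  rewrite (eq_bigr (fun w => 1 - eta w)) => [|w wv].
    by move: (eta v) (\sum_(_ | _) _) => z S; lia.
  by rewrite !ffunE (negbTE (_ : val w != val v)) ?addr0 // val_eqE.
have mu_xi : mu (eta + delta a b (val v)) = 0.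
  apply: IH => //; have := deficit_ge0 _ st'; rewrite deficitD.
  by move: dlt; rewrite ltnS; lia.
have := stationary_ge [fset eta]%fset (eta + delta a b (val v)).
rewrite big_seq_fset1 mu_xi pmulr_lle0 // => le0.
by apply/eqP; rewrite eq_le le0 mu0.
Qed.

Lemma stationary_sum1 : \sum_(eta <- recurrents) mu eta = 1.
Proof.
have [mu0 _ mu1 _] := mu_st; apply: EFin_inj.
rewrite -mu1 -sumEFin (esum_support (X := recurrents)) // => eta.
by move=> /stationary_support ->.
Qed.

Lemma stationary_recurrents xi :
  mu xi = \sum_(eta <- recurrents) mu eta * step eta xi.
Proof.
have [mu0 _ _ muE] := mu_st; apply: EFin_inj; rewrite muE -sumEFin.
rewrite (esum_support (X := recurrents)) => [|eta|eta /stationary_support ->].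
- by apply: eq_bigr => eta _; rewrite step_lawE.
- by rewrite step_lawE // -EFinM lee_fin mulr_ge0 ?step_law_ge0.
- by rewrite mul0e.
Qed.

End Uniqueness.

(* [dif] is invariant and vanishes at the full configuration.  Since the rows sum
   to 1, |dif| is invariant as well, so no state leading to the full
   configuration in one step carries any of it. *)
Lemma stationary_unique (R : realType) (a b : int) (M : toppling_model R a b)
    (mu nu : config a b -> R) : a <= b ->
  stationary M mu -> stationary M nu -> 0 < nu (full a b) -> mu = nu.
Proof.
move=> ab mu_st nu_st nu_full.
(* This ratio makes [dif] vanish at the full configuration. *)
pose t := mu (full a b) / nu (full a b).
pose dif xi := mu xi - t * nu xi.
pose Rec := recurrents a b.
have difE xi : dif xi = \sum_(eta <- Rec) dif eta * step_law M eta xi.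
  rewrite /dif (stationary_recurrents ab mu_st) (stationary_recurrents ab nu_st).
  rewrite mulr_sumr -sumrB; apply: eq_bigr => eta _; ring.
(* The defect in the triangle inequality for [difE]: it is nonnegative with total 0 over the class,
   hence zero at each recurrent state. *)
pose gap xi := \sum_(eta <- Rec) `|dif eta| * step_law M eta xi - `|dif xi|.
have gap_ge0 xi : 0 <= gap xi.
  rewrite subr_ge0 difE (le_trans (ler_norm_sum _ _ _)) // ler_sum // => eta _.
  by rewrite normrM (ger0_norm (step_law_ge0 _ _ _)).
have gap_sum : \sum_(xi <- Rec) gap xi = 0.
  rewrite sumrB exchange_big /=; apply/eqP; rewrite subr_eq0; apply/eqP.
  by apply: eq_big_seq => eta etaR; rewrite -mulr_sumr sum_step_recurrent ?mulr1.
have gap_full : gap (full a b) = 0.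
  move/eqP: gap_sum; rewrite (bigD1_seq (full a b)) ?fset_uniq ?full_recurrents //=.
  rewrite paddr_eq0 // ?sumr_ge0 //; first by case/andP => /eqP.
have dif_full : dif (full a b) = 0.
  by rewrite /dif /t divfK ?subrr // gt_eqF.
have dif0 eta : eta \in Rec -> dif eta = 0.
  move=> etaR; have [->//|neq] := eqVneq eta (full a b).
  have [v [v0 st]] : exists v, eta v <= 0 /\ stable (eta + delta a b (val v)).
    have [k _ etak] := recurrentsP _ etaR.
    by apply: exists_hole => //; rewrite etak stable_threshold.
  (* A recurrent configuration other than the full one has a single hole. *)
  have eta_full : eta + delta a b (val v) = full a b.
    have [k _ etak] := recurrentsP _ etaR; move: v0.
    rewrite etak config_of_threshold // !ffunE => v0.
    suff <- : a + k%:Z - 1 = val v by rewrite subrK.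
    by move: v0; case: eqP => // _; lia.
  have term_ge0 xi : 0 <= `|dif xi| * step_law M xi (full a b).
    by apply: mulr_ge0; [exact: normr_ge0|exact: step_law_ge0].
  have /eqP := gap_full.
  rewrite /gap dif_full normr0 subr0 (bigD1_seq eta) ?fset_uniq //=.
  rewrite (paddr_eq0 (term_ge0 eta) (sumr_ge0 _ (fun xi _ => term_ge0 xi))).
  case/andP=> + _; rewrite mulf_eq0 normr_eq0 => /orP[/eqP//|].
  by rewrite gt_eqF // -eta_full step_law_add.
(* Both measures have total mass 1 on the recurrent class. *)
have t1 : t = 1.
  have := stationary_sum1 ab mu_st.
  rewrite (eq_big_seq (fun eta => t * nu eta)) => [|eta etaR].
    by rewrite -mulr_sumr (stationary_sum1 ab nu_st) mulr1.
  by apply/eqP; rewrite -subr_eq0 -/(dif eta) dif0.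
apply/funext => eta; have [etaR|etaR] := boolP (eta \in Rec).
  by move/eqP: (dif0 _ etaR); rewrite /dif t1 mul1r subr_eq0 => /eqP.
by rewrite (stationary_support ab mu_st) // (stationary_support ab nu_st).
Qed.

(** * Identification of [mu_stoch] and the infinite volume limit *)

Lemma mu_stoch_law (R : realType) (a b : int) (M : toppling_model R a b) :
  a <= b -> mu_stoch M = law R (a:=a) (b:=b).
Proof.
move=> ab; have law_st := stationary_law ab M.
apply: (stationary_unique ab _ law_st).
  exact: (xgetPex (fun=> 0) (ex_intro _ _ law_st)).
rewrite law_full // addr_gt0 // ?divr_gt0 // ?mulr_gt0 // ltr0n.
Qed.

Lemma edge_count_intr (R : realType) (a b : int) : a < 0 -> 0 < b ->
  (`|a| + b + 2)%:~R = `|b - a|.+2%:R :> R.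
Proof.
move=> a0 b0; rewrite (_ : `|a| + b + 2 = `|b - a|.+2%:Z) ?pmulrn //.
by rewrite ltr0_norm //; lia.
Qed.

(** Union bound: a recurrent configuration fails to be full on [A] only if its hole lies in [A], and
    each hole has mass 1/(2n). *)
Lemma mu_stoch_full_on (R : realType) (a b : int) (M : toppling_model R a b)
    (A : {fset int}) : a <= b -> (forall x, x \in A -> a <= x <= b) ->
  exists2 p : R, mu_stoch_event M (full_on A) = p%:E &
    1 - #|` A|%:R / (2 * `|b - a|.+2%:R) <= p <= 1.
Proof.
move=> ab Aab; set n := `|b - a|.+2.
pose good k : bool := `[< full_on A (config_of_string (threshold a b k)) >].
have level_ge0 := level_law_ge0 R a b.
exists (\sum_(k < n.+1) level_law R a b k * (good k)%:R).
  rewrite /mu_stoch_event mu_stoch_law // esum_mkcond.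
  rewrite (eq_esum (b := fun eta => (law R eta)%:E * (`[< full_on A eta >]%:R)%:E)%E).
    rewrite esum_law => [|eta]; last by rewrite lee_fin ler0n.
    by rewrite -sumEFin; apply: eq_bigr => k _; rewrite EFinM.
  move=> eta _; rewrite -[eta \in _]/(asbool _).
  by case: asboolP => _; rewrite ?mule1 ?mule0.
apply/andP; split; last first.
  rewrite -[leRHS](sum_level_law R a b).
  apply: ler_sum => k _; rewrite -[leRHS]mulr1 ler_wpM2l //.
  by rewrite lern1 leq_b1.
rewrite lerBlDr -lerBlDl -[X in X - _](sum_level_law R a b) -sumrB.
apply: (@le_trans _ _ (\sum_(k < n.+1) \sum_(y <- A)
  (2 * n%:R)^-1 * (a + k%:Z - 1 == y)%:R)).
  apply: ler_sum => k _; rewrite -{1}[level_law _ _ _ _]mulr1 -mulrBr.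
  have sum_ge0 (B : seq int) :
      0 <= \sum_(y <- B) (2 * n%:R)^-1 * (a + k%:Z - 1 == y)%:R :> R.
    by apply: sumr_ge0 => y _; rewrite mulr_ge0 ?invr_ge0 ?mulr_ge0 ?ler0n.
  case: (boolP (good k)) => [_|bad]; first by rewrite subrr mulr0.
  have yA : a + k%:Z - 1 \in A.
    apply: contraNT bad => yA; apply/asboolP => x xA.
    have zx : x \in zrange a b by rewrite mem_zrange Aab.
    exists (SeqSub zx) => //; rewrite config_of_threshold // !ffunE /=.
    by case: eqP => [xy|]; [move: yA; rewrite -xy xA|rewrite subr0].
  rewrite subr0 mulr1 (bigD1_seq (a + k%:Z - 1)) ?fset_uniq //= eqxx mulr1.
  have := Aab _ yA => yab.
  have k0 : (k == 0%N :> nat) = false by apply/negbTE; lia.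
  have kn : (k == n :> nat) = false by apply/negbTE; lia.
  rewrite /level_law k0 kn !mulr0 !addr0 lerDl.
  by apply: sumr_ge0 => y _; rewrite mulr_ge0 ?invr_ge0 ?mulr_ge0 ?ler0n.
rewrite exchange_big /= [leRHS]mulrC.
have -> : (2 * n%:R)^-1 * #|` A|%:R = \sum_(y <- A) (2 * n%:R)^-1 :> R.
  by rewrite big_const_seq count_predT iter_addr_0 mulr_natr.
(* Each site [y] is the hole of at most one threshold. *)
apply: ler_sum => y _; rewrite -mulr_sumr ler_piMr ?invr_ge0 ?mulr_ge0 ?ler0n //.
have [/existsP[k /eqP ky]|/existsPn none] :=
  boolP [exists k : 'I_n.+1, a + (k : nat)%:Z - 1 == y].
  rewrite (bigD1 k) //= ky eqxx big1 ?addr0 // => l lk.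
  rewrite (_ : (_ == y) = false) //; apply: contraNF lk => /eqP ly.
  by apply/eqP/val_inj => /=; lia.
by rewrite big1 // => k _; rewrite (negbTE (none k)).
Qed.

Theorem theorem1p1 (R : realType) :
  [/\ (forall (a b : int) (M : toppling_model R a b), a < 0 -> 0 < b ->
         mu_stoch M (full a b) = 1 / 2 + 1 / (2 * (`|a| + b + 2)%:~R)),
      (forall (a b : int) (M : toppling_model R a b) (j : int),
         a < 0 -> 0 < b -> a <= j <= b ->
         mu_stoch M (full a b - delta a b j) = 1 / (2 * (`|a| + b + 2)%:~R)) &
      (forall (a_ b_ : nat -> int)
              (M : forall n, toppling_model R (a_ n) (b_ n)),
         (forall n, a_ n < 0) -> (forall n, 0 < b_ n) ->
         ((a_ n)%:~R : R) @[n --> \oo] --> -oo ->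
         ((b_ n)%:~R : R) @[n --> \oo] --> +oo ->
         forall A : {fset int},
           mu_stoch_event (M n) (full_on A) @[n --> \oo]
             --> 1%E)].
Proof.
have le_ab (a b : int) : a < 0 -> 0 < b -> a <= b by move=> *; lia.
split=> [a b M a0 b0|a b M j a0 b0 jab|a_ b_ M a0 b0 aoo boo A].
- by have ab := le_ab _ _ a0 b0; rewrite mu_stoch_law // law_full // edge_count_intr.
- by have ab := le_ab _ _ a0 b0; rewrite mu_stoch_law // law_hole // edge_count_intr.
have ab i := le_ab _ _ (a0 i) (b0 i).
(* A bound for [A]: the interval contains [A] as soon as it contains -C and C. *)
pose C : int := \sum_(x <- A) `|x|.
have xC x : x \in A -> `|x| <= C.
  move=> xA; rewrite /C (bigD1_seq x) ?fset_uniq //= lerDl.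
  by apply: sumr_ge0 => y _; exact: normr_ge0.
have near_ab : \forall i \near \oo, forall x, x \in A -> a_ i <= x <= b_ i.
  near=> i => x /xC xleC.
  have : (a_ i)%:~R <= (- C)%:~R :> R by near: i; move/cvgrNyPle: aoo; apply.
  have : C%:~R <= (b_ i)%:~R :> R by near: i; move/cvgryPge: boo; apply.
  rewrite !ler_int; lia.
have to_fine i : (forall x, x \in A -> a_ i <= x <= b_ i) ->
  mu_stoch_event (M i) (full_on A) \is a fin_num /\
  1 - #|` A|%:R / (2 * `|b_ i - a_ i|.+2%:R) <=
    fine (mu_stoch_event (M i) (full_on A)) <= 1.
  by move=> /(mu_stoch_full_on (M i) (ab i))[p ->].
apply/fine_cvgP; split.
  by apply: filterS near_ab => i /to_fine[].
apply/cvgrPdist_le => e e0; near=> i.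
have /to_fine[_ /andP[lo hi]] : forall x, x \in A -> a_ i <= x <= b_ i.
  by near: i.
rewrite ger0_norm ?subr_ge0 //= lerBlDl addrC -lerBlDl.
apply: le_trans lo; rewrite lerD2l lerN2.
(* Since b is at most n, this bound makes the error |A|/(2n) at most [e]. *)
have be : #|` A|%:R / e <= (b_ i)%:~R.
  by near: i; move/cvgryPge: boo; apply.
have bn : (b_ i)%:~R <= `|b_ i - a_ i|.+2%:R :> R.
  rewrite pmulrn ler_int; have := a0 i; have := b0 i; lia.
rewrite ler_pdivrMr ?mulr_gt0 ?ltr0n //.
move: be; rewrite ler_pdivrMr // => be.
have be_ne := ler_wpM2r (ltW e0) bn.
apply: (le_trans be); apply: (le_trans be_ne).
by rewrite mulrC ler_wpM2l ?(ltW e0) // ler_peMl ?ler0n // ler1n.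
Unshelve. all: by end_near. Qed.
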